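(* Let $x\in\mathcal X$ and let $\alpha,\gamma$ denote probability levels with $\alpha<\gamma$. Then for the random variable $\mathbb T(x)$, $$\mathrm{VaR}_{\gamma}\mathbb T(x)=\lim_{\alpha\uparrow\gamma}\mathbb E_{\alpha-\gamma}[\mathbb T(x)].$$
   Context: Let $\mathcal X\subseteq\mathbb R^k$ be nonempty and let $Y$ be a discrete random vector in $\mathbb R^m$ on a probability space with probability measure $\mathbb P$, having $n$ distinct realizations (atoms) $y_1,\dots,y_n$ with probabilities $p_1,\dots,p_n$ ($p_i>0$, $\sum_i p_i=1$). Let $f:\mathcal X\times\mathbb R^m\to\mathbb R$ be such that for each fixed realization $y$ of $Y$, $f(x,y)$ is linear in $x$. For $x\in\mathcal X$ put $\mathbb T(x)=f(x,Y)$ and $T_i(x)=f(x,y_i)$, so $\mathbb T(x)$ has realizations $T_i(x)$ with associated probabilities $p_i$. Let $F(t)=\mathbb P(\mathbb T(x)\le t)$ and $F^{-1}(p)=\inf\{t: F(t)\ge p\}$. Probability levels are numbers in $[0,1]$. Value-at-risk: $\mathrm{VaR}_p\mathbb T(x)=\inf\{\eta\in\mathbb R:\mathbb P(\mathbb T(x)\le\eta)\ge p\}=F^{-1}(p)$. For $0\le\alpha<1$, $\mathbb E_{\alpha-1}[\mathbb T(x)]=\frac1{1-\alpha}\max\{\sum_{i=1}^n T_i(x)w_ip_i : w\in[0,1]^n,\ \sum_{i=1}^n w_ip_i=1-\alpha\}$. For $0\le\alpha<\gamma\le1$, the $\alpha-\gamma$ expectation is $\mathbb E_{\alpha-\gamma}[\mathbb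 T(x)]=\frac1{\gamma-\alpha}\big((1-\alpha)\mathbb E_{\alpha-1}[\mathbb T(x)]-(1-\gamma)\mathbb E_{\gamma-1}[\mathbb T(x)]\big)$ (the last term is $0$ if $\gamma=1$); equivalently it is $\frac1{\gamma-\alpha}\int_\alpha^\gamma F^{-1}(p)\,dp$. *)

(* Defs.v *)
From HB Require Import structures.
From mathcomp Require Import all_boot all_order all_algebra.
From mathcomp Require Import all_classical all_reals all_analysis.

Set Implicit Arguments.
Unset Strict Implicit.
Unset Printing Implicit Defensive.

Import Order.TTheory GRing.Theory Num.Theory.
Import numFieldNormedType.Exports.

Local Open Scope classical_set_scope.
Local Open Scope ring_scope.

(* Random vectors take values in [m.-tuple R], which the
   library equips with the product sigma-algebra. *)

(* The elements [y i] are the distinct atoms of [Y], with probabilities [p i].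
   Since the [p i] sum to 1, every other point of the countable range of [Y]
   has probability 0. *)
Definition has_atoms (d : measure_display) (Omega : measurableType d)
    (R : realType) (P : probability Omega R) (m n : nat)
    (Y : {dRV P >-> m.-tuple R}) (y : 'I_n -> m.-tuple R) (p : 'I_n -> R) :
    Prop :=
  [/\ injective y,
      forall i, P [set w | Y w = y i] = (p i)%:E,
      forall i, 0 < p i &
      \sum_(i < n) p i = 1].

Definition linear_on (R : realType) (k : nat) (X : set 'rV[R]_k)
    (g : 'rV[R]_k -> R) : Prop :=
  exists h : {linear 'rV[R]_k -> R^o}, forall x, X x -> g x = h x.

Definition VaR (d : measure_display) (Omega : measurableType d)
    (R : realType) (P : probability Omega R) (Z : Omega -> R) (q : R) : R :=
  inf [set eta : R | (q%:E <= P [set w | Z w <= eta]%R)%E].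

(* The greatest element of [A] (0 if there is none). *)
Definition set_max (R : realType) (A : set R) : R :=
  xget 0 (A `&` ubound A).

(* In the next two definitions, [t i] and [p i] are the realizations of the
   random variable and their probabilities.  The maximum below is over a
   compact set, nonempty as soon as [0 <= alpha <= 1] and the [p i] are
   nonnegative of sum 1, so that [set_max] never returns its default value. *)
Definition tail_expectation (R : realType) (n : nat) (t p : 'I_n -> R)
    (alpha : R) : R :=
  (1 - alpha)^-1 *
  set_max [set \sum_(i < n) t i * w i * p i | w in
             [set w : 'I_n -> R | (forall i, 0 <= w i <= 1) /\
                                  \sum_(i < n) w i * p i = 1 - alpha]].

(* For [gamma = 1] the last term is 0, thanks to its factor [1 - gamma]. *)
Definition range_expectation (R : realType) (n : nat) (t p : 'I_n -> R)
    (alpha gamma : R) : R :=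
  (gamma - alpha)^-1 *
  ((1 - alpha) * tail_expectation t p alpha
   - (1 - gamma) * tail_expectation t p gamma).

(* Main.v *)
Require Import Defs.
From HB Require Import structures.
From mathcomp Require Import all_boot all_order all_algebra.
From mathcomp Require Import all_classical all_reals all_analysis.
From mathcomp Require Import ring lra.

(** For a finite discrete law, taking the value [t i] with probability [p i],
    the quantile function is a step function that is constant to the left of
    every level.  Let [v] be the [gamma]-quantile, characterized by
    P(T < v) < gamma <= P(T <= v).  For every level [alpha] with
    P(T < v) <= alpha <= P(T <= v), the maximum that defines the tail
    expectation has the closed form of Rockafellar and Uryasev,
      (1 - alpha) E_(alpha-1) = v (1 - alpha) + E (T - v)^+
    ([tail_expectation_quantile]): one writes t = v + (t - v) and bounds
    (t - v) w by (t - v)^+, with equality when the weight [w] is 1 above [v],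
    0 below [v], and a constant at [v] that uses up the remaining mass.  Both
    [alpha] and [gamma] satisfy these bounds when P(T < v) <= alpha < gamma, so
    in the difference that defines the range expectation the term E (T - v)^+
    cancels, and what is left is exactly [v] ([range_expectation_quantile]).
    The function of [alpha] is thus constant, equal to [v], on a left
    neighbourhood of [gamma].

    It remains to see that the value-at-risk of [f x (Y w)] is this [v].  As
    the range of [Y] is countable and points are measurable, every event that
    depends on [Y] only is measurable, whatever [f] is, and its probability is
    the sum of the [p i] over the atoms that belong to it ([prob_atoms]). *)

Import Order.TTheory GRing.Theory Num.Theory.
Import numFieldNormedType.Exports.

Local Open Scope classical_set_scope.
Local Open Scope ring_scope.

Lemma set_max_eq (R : realType) (A : set R) (M : R) :
  A M -> ubound A M -> set_max A = M.
Proof.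
move=> AM uM; apply: xget_unique => // z [Az uz].
by apply/eqP; rewrite eq_le uM // uz.
Qed.

Lemma sum_pred_le {R : realType} {n : nat} {p : 'I_n -> R} (A B : pred 'I_n) :
  (forall i, 0 < p i) -> subpred A B ->
  \sum_(i | A i) p i <= \sum_(i | B i) p i.
Proof.
move=> p0 AB; rewrite big_mkcond [leRHS]big_mkcond; apply: ler_sum => i _.
by case: ifPn => [/AB ->|_] //; case: ifPn => // _; exact: ltW.
Qed.

(** Take for [t j] the largest value on [A]: the atoms of [A] are then among
    those with [t i <= t j].  This is how an inequality on the mass of a set of
    atoms is turned into one on the distribution function at a value of the
    law. *)
Lemma mass_at_largest_value {R : realType} {n : nat} {t p : 'I_n -> R}
    {gamma : R} (A : pred 'I_n) :
  (forall i, 0 < p i) -> 0 < gamma -> gamma <= \sum_(i | A i) p i ->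
  exists2 j, A j & gamma <= \sum_(i | t i <= t j) p i.
Proof.
move=> p0 g0 gA; case: (pickP A) => [i0 Ai0|A0]; last first.
  by move: gA; rewrite big_pred0 // leNgt g0.
case: (@arg_maxP _ _ _ i0 A t Ai0) => j Aj tj; exists j => //.
exact: le_trans gA (sum_pred_le _ _ p0 tj).
Qed.

(** The quantile is the least value [t i] at which the distribution function
    reaches [gamma]: if the values below it had mass at least [gamma], the
    largest of them would be smaller and reach [gamma] already. *)
Lemma quantile_exists {R : realType} {n : nat} (t p : 'I_n -> R) (gamma : R) :
  (forall i, 0 < p i) -> \sum_i p i = 1 -> 0 < gamma -> gamma <= 1 ->
  exists v, \sum_(i | t i < v) p i < gamma <= \sum_(i | t i <= v) p i.
Proof.
move=> p0 p1 g0 g1.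
have [|i0 _ gi0] := @mass_at_largest_value _ _ t p gamma predT p0 g0.
  by rewrite p1.
pose Q := [pred i | gamma <= \sum_(j | t j <= t i) p j].
case: (@arg_minP _ _ _ i0 Q t gi0) => i Qi ti.
exists (t i); rewrite (Qi : is_true (gamma <= _)) andbT ltNge; apply/negP => gA.
have [j tji gj] := @mass_at_largest_value _ _ t p gamma _ p0 g0 gA.
by have := ti _ gj; rewrite leNgt tji.
Qed.

Lemma sum_split3 {R : realType} {n : nat} (t F : 'I_n -> R) (v : R) :
  \sum_i F i = \sum_(i | t i < v) F i + \sum_(i | t i == v) F i
               + \sum_(i | v < t i) F i.
Proof.
rewrite [\sum_(i | _ < v) _]big_mkcond [\sum_(i | _ == _) _]big_mkcond.
rewrite [\sum_(i | v < _) _]big_mkcond -!big_split /=; apply: eq_bigr => i _.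
by case: ltgtP; rewrite ?addr0 ?add0r.
Qed.

Lemma sum_le_split (R : realType) (n : nat) (t F : 'I_n -> R) (v : R) :
  \sum_(i | t i <= v) F i =
  \sum_(i | t i < v) F i + \sum_(i | t i == v) F i.
Proof.
rewrite [LHS]big_mkcond [\sum_(i | _ < v) _]big_mkcond.
rewrite [\sum_(i | _ == _) _]big_mkcond -!big_split /=; apply: eq_bigr => i _.
by case: ltgtP; rewrite ?addr0 ?add0r.
Qed.

(** This is the formula of Rockafellar and Uryasev: the upper bound holds for
    every real [v], and the hypotheses on [v] say exactly that the optimal
    weights can be completed by a weight at [v] lying in the unit interval. *)
Lemma tail_expectation_quantile (R : realType) (n : nat) (t p : 'I_n -> R)
    (v alpha : R) :
  (forall i, 0 < p i) -> \sum_i p i = 1 ->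
  \sum_(i | t i < v) p i < \sum_(i | t i <= v) p i ->
  \sum_(i | t i < v) p i <= alpha <= \sum_(i | t i <= v) p i ->
  alpha <= 1 ->
  (1 - alpha) * tail_expectation t p alpha =
  v * (1 - alpha) + \sum_(i | v < t i) (t i - v) * p i.
Proof.
move=> p0 p1 ltm /andP[lea gea] a1.
have := sum_split3 t p v; rewrite p1 => split1.
move: ltm gea; rewrite sum_le_split => ltm gea.
set L := \sum_(i | t i < v) p i in split1 ltm lea gea.
set E := \sum_(i | t i == v) p i in split1 ltm gea.
set G := \sum_(i | v < t i) p i in split1.
case: (eqVneq alpha 1) => [alpha1|an1].
  (* The inverse of [1 - alpha] is here the default value 0.  The closed form
     vanishes too: P(T <= v) = 1 leaves no mass above [v]. *)
  have G0 : G = 0.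
    have : 0 <= G by apply: sumr_ge0 => i _; exact: ltW.
    by lra.
  rewrite alpha1 subrr mulr0 mul0r add0r big1 // => i vt.
  by have /psumr_eq0P := G0 => /(_ (fun i _ => ltW (p0 i))) -> //; rewrite mulr0.
rewrite /tail_expectation mulrA divff ?mul1r; last by rewrite subr_eq0 eq_sym.
have E0 : 0 < E by lra.
apply: set_max_eq.
- (* [lambda] spreads the mass left by the values above [v] evenly over the
     atoms located at [v]. *)
  pose lambda := (1 - alpha - G) / E.
  have l01 : 0 <= lambda <= 1.
    by rewrite /lambda ler_pdivrMr // divr_ge0; lra.
  pose w i := if t i < v then 0 else if t i == v then lambda else 1.
  exists w => /=.
    split=> [i|]; first by rewrite /w; case: ltgtP => // _; rewrite lexx ler01.
    rewrite (sum_split3 t _ v) big1 ?add0r; last first.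
      by move=> i tv; rewrite /w tv mul0r.
    rewrite (eq_bigr (fun i => lambda * p i)); last first.
      by move=> i /eqP tv; rewrite /w tv ltxx eqxx.
    rewrite [X in _ + X](eq_bigr p); last first.
      by move=> i tv; rewrite /w ltNge (ltW tv) gt_eqF //= mul1r.
    by rewrite -mulr_sumr -/E -/G /lambda divfK ?gt_eqF // subrK.
  rewrite (sum_split3 t _ v) big1 ?add0r; last first.
    by move=> i tv; rewrite /w tv mulr0 mul0r.
  rewrite (eq_bigr (fun i => v * lambda * p i)); last first.
    by move=> i /eqP tv; rewrite /w tv ltxx eqxx.
  rewrite [X in _ + X](eq_bigr (fun i => (t i - v) * p i + v * p i)); last first.
    by move=> i tv; rewrite /w ltNge (ltW tv) gt_eqF //=; ring.
  rewrite big_split /= -!mulr_sumr -/E -/G -mulrA /lambda divfK ?gt_eqF //.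
  by ring.
- move=> _ [w [w01 ws] <-].
  have -> : \sum_i t i * w i * p i =
      v * (1 - alpha) + \sum_i (t i - v) * w i * p i.
    rewrite -ws mulr_sumr -big_split /=; apply: eq_bigr => i _; ring.
  rewrite lerD2l [leRHS]big_mkcond; apply: ler_sum => i _.
  have pi0 := p0 i; have /andP[w0 w1] := w01 i.
  case: (ltP v (t i)) => tv; first by rewrite ler_pM2r // ler_piMr //; lra.
  by apply: mulr_le0_ge0; [apply: mulr_le0_ge0|]; lra.
Qed.

Lemma range_expectation_quantile (R : realType) (n : nat) (t p : 'I_n -> R)
    (v alpha gamma : R) :
  (forall i, 0 < p i) -> \sum_i p i = 1 ->
  \sum_(i | t i < v) p i <= alpha -> alpha < gamma ->
  gamma <= \sum_(i | t i <= v) p i -> gamma <= 1 ->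
  range_expectation t p alpha gamma = v.
Proof.
move=> p0 p1 la ag gv g1; rewrite /range_expectation.
rewrite (@tail_expectation_quantile _ _ t p v alpha) //; [|lra..].
rewrite (@tail_expectation_quantile _ _ t p v gamma) //; [|lra..].
by field; lra.
Qed.

Lemma measurable_tuple_set1 (R : realType) (m : nat) (v : m.-tuple R) :
  measurable [set v].
Proof.
have -> : [set v] = \bigcap_(i in [set: 'I_m])
    ((fun u : m.-tuple R => tnth u i) @^-1` [set tnth v i]).
  apply/seteqP; split=> [u -> //|u uv].
  by apply: eq_from_tnth => i; exact: uv.
apply: fin_bigcap_measurable => // i _.
by rewrite -[X in measurable X]setTI; apply: measurable_tnth.
Qed.

(** Countability of the range replaces measurability of [S]. *)
Lemma measurable_dRV_event {d : measure_display} {Omega : measurableType d}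
    {R : realType} {P : probability Omega R} {m : nat}
    (Y : {dRV P >-> m.-tuple R}) (S : set (m.-tuple R)) :
  measurable [set w | S (Y w)].
Proof.
have -> : [set w | S (Y w)] = Y @^-1` (S `&` range Y).
  by apply/seteqP; split=> [w Sw|w []//]; split => //; exists w.
rewrite -[X in measurable X]setTI.
apply: (measurable_funPT Y) => //.
apply: countable_measurable; first exact: measurable_tuple_set1.
exact: sub_countable (subset_card_le (@subIsetr _ _ _)) (@countable_range _ _ _ _ Y).
Qed.

(** Additivity gives one inequality for [S] and one for its complement; as the
    two bounds add up to 1, both are equalities. *)
Lemma prob_atoms {d : measure_display} {Omega : measurableType d}
    {R : realType} {P : probability Omega R} {m n : nat}
    {Y : {dRV P >-> m.-tuple R}} {y : 'I_n -> m.-tuple R} {p : 'I_n -> R}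
    (Y_atoms : has_atoms Y y p) (S : pred (m.-tuple R)) :
  P [set w | S (Y w)] = (\sum_(i | S (y i)) p i)%:E.
Proof.
case: Y_atoms => y_inj yp _ p1.
have lower (A : pred (m.-tuple R)) :
    ((\sum_(i | A (y i)) p i)%:E <= P [set w | A (Y w)])%E.
  have my i : measurable [set w | Y w = y i].
    exact: (measurable_dRV_event Y [set y i]).
  rewrite -sumEFin (eq_bigr (fun i => P [set w | Y w = y i])); last first.
    by move=> i _; rewrite yp.
  rewrite -(@measure_bigsetU_ord_cond _ _ _ P _ (fun i => A (y i))) //; last first.
    move=> i j _ _ [w [/= wi wj]]; apply: y_inj; exact: etrans (esym wi) wj.
  apply: le_measure; rewrite ?inE.
  - exact: bigsetU_measurable.
  - exact: (measurable_dRV_event Y [set u | A u]).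
  - by rewrite -bigcup_pred => w [i /= Ai wi]; rewrite /= wi.
apply/eqP; rewrite eq_le lower andbT.
have := lower (predC S).
have -> : [set w | predC S (Y w)] = ~` [set w | S (Y w)].
  by apply/seteqP; split=> w /= /negP.
have mS : measurable [set w | S (Y w)].
  exact: (measurable_dRV_event Y [set u | S u]).
rewrite probability_setC //.
rewrite -[P _]fineK ?fin_num_measure // -EFinB !lee_fin.
by move: p1; rewrite (bigID (fun i => S (y i))) /=; lra.
Qed.

Lemma VaR_quantile (d : measure_display) (Omega : measurableType d)
    (R : realType) (P : probability Omega R) (n : nat) (Z : Omega -> R)
    (t p : 'I_n -> R) (gamma v : R) :
  (forall eta, P [set w | Z w <= eta] = (\sum_(i | t i <= eta) p i)%:E) ->
  (forall i, 0 < p i) ->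
  \sum_(i | t i < v) p i < gamma <= \sum_(i | t i <= v) p i ->
  VaR P Z gamma = v.
Proof.
move=> cdf p0 /andP[ltv lev]; rewrite /VaR.
have lbv : lbound [set eta | (gamma%:E <= P [set w | (Z w <= eta)%R])%E] v.
  move=> eta /=; rewrite cdf lee_fin => geta; rewrite leNgt; apply/negP => etav.
  have := sum_pred_le (fun i => t i <= eta) (fun i => t i < v) p0
    (fun i ti => le_lt_trans ti etav).
  by rewrite leNgt (lt_le_trans ltv geta).
have vin : [set eta | (gamma%:E <= P [set w | (Z w <= eta)%R])%E] v.
  by rewrite /= cdf lee_fin.
apply/eqP; rewrite eq_le lb_le_inf ?andbT //; last by exists v.
by apply: ge_inf => //; exists v.
Qed.

Theorem proposition1 (R : realType) (d : measure_display)
    (Omega : measurableType d) (P : probability Omega R) (k m n : nat)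
    (X : set 'rV[R]_k) (X_nonempty : X !=set0)
    (Y : {dRV P >-> m.-tuple R}) (y : 'I_n -> m.-tuple R) (p : 'I_n -> R)
    (Y_atoms : has_atoms Y y p)
    (f : 'rV[R]_k -> m.-tuple R -> R)
    (f_linear : forall i : 'I_n, linear_on X (fun x => f x (y i)))
    (x : 'rV[R]_k) (Xx : X x)
    (gamma : R) (gamma_gt0 : 0 < gamma) (gamma_le1 : gamma <= 1) :
  range_expectation (fun i => f x (y i)) p alpha gamma @[alpha --> gamma^'-]
    --> VaR P (fun w => f x (Y w)) gamma.
Proof.
have [_ _ p0 p1] := Y_atoms.
have [v qv] := quantile_exists (fun i => f x (y i)) p gamma p0 p1
  gamma_gt0 gamma_le1.
have -> : VaR P (fun w => f x (Y w)) gamma = v.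
  apply: VaR_quantile p0 qv => eta.
  exact: (prob_atoms Y_atoms (fun u => f x u <= eta)).
have /andP[ltv lev] := qv.
apply: cvg_near_cst; near=> alpha.
apply: range_expectation_quantile => //.
near: alpha; exact: nbhs_left_ge.
Unshelve. all: by end_near.
Qed.
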